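(* Let $X$ be a fibrewise $H$-space over a topological space $B$ which admits a fibrewise division map. Then $$\mathrm{TC}_B(X)=\mathrm{cat}_B^*(X).$$
   Context: Fix a topological space $B$ and let $I=[0,1]$. A fibrewise space over $B$ is a space $X$ with a continuous map $p_X:X\to B$; a fibrewise map $f:X\to Y$ is a continuous map with $p_Y\circ f=p_X$; subspaces $U\subset X$ are fibrewise spaces via $p_X|_U$. A fibrewise homotopy ($\simeq_B$) is a homotopy $H:X\times I\to Y$ between fibrewise maps with $p_Y(H(x,t))=p_X(x)$ for all $x,t$. A fibrewise pointed space is a fibrewise space $X$ with a section $s_X:B\to X$ of $p_X$; a fibrewise pointed map is a fibrewise map $f$ with $f\circ s_X=s_Y$; a fibrewise pointed homotopy ($\simeq^B_B$) is a fibrewise homotopy $H$ with $H(s_X(b),t)=s_Y(b)$ for all $b\in B$, $t\in I$. The fibrewise product $X\times_B X=\{(x,y)\in X\times X:p_X(x)=p_X(y)\}$ is fibrewise pointed with section $b\mapsto(s_X(b),s_X(b))$; $pr_1,pr_2$ are its projections. A fibrewise $H$-space is a fibrewise pointed space $X$ with a fibrewise pointed map $\mu:X\times_B X\to X$ such that $\mu\circ i_1\simeq^B_B id_X$ and $\mu\circ i_2\simeq^B_B id_X$, where $i_1=(id_X,s_X\circ p_X)$, $i_2=(s_X\circ p_X,id_X)$. A fibrewise division on $X$ is a fibrewise pointed map $\delta:X\times_B X\to X$ with $\mu\circ(pr_1,\delta)\simeq^B_B pr_2$. Fibrewise unpointed LS category: $\mathrm{cat}_B^*(X)$ is the smallest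 integer $n\ge0$ such that $X$ has an open cover $\{U_0,\dots,U_n\}$ with $\mathrm{inc}_{U_i}\simeq_B s_X\circ p_X|_{U_i}$ (as fibrewise maps $U_i\to X$) for all $i$; $\infty$ if none exists. Fibrewise (parametrized) topological complexity: $\mathrm{TC}_B(X)$ is the fibrewise sectional category of $\Pi_X:P_B(X)\to X\times_B X$, $\Pi_X(b,\alpha)=(\alpha(0),\alpha(1))$, where $P_B(X)=\{(b,\alpha)\in B\times X^I: p_X\circ\alpha\text{ is the constant path at }b\}$ (compact-open topology on $X^I$); that is, the smallest $n\ge0$ such that $X\times_B X$ has an open cover $\{U_0,\dots,U_n\}$ with fibrewise maps $s_i:U_i\to P_B(X)$ satisfying $\Pi_X\circ s_i\simeq_B\mathrm{inc}_{U_i}$ for all $i$ ($\infty$ if none exists). *)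

(* Defs.v *)
Set Warnings "-notation-overridden,-ambiguous-paths".
From mathcomp Require Import all_boot all_order all_algebra.
From mathcomp Require Import all_classical reals topology normedtype.

Set Implicit Arguments.
Unset Strict Implicit.
Unset Printing Implicit Defensive.

Import Order.TTheory GRing.Theory Num.Theory.
Import numFieldNormedType.Exports.

Local Open Scope classical_set_scope.
Local Open Scope ring_scope.

(* In this file a subset [A : set T] of a topological space, used as a type,
   is [set_type A], which carries the subspace topology. *)

Section UnitInterval.
Variable R : realType.

Definition unitI : topologicalType := set_type (`[0, 1]%classic : set R).

Lemma mem0_unitI : (0 : R) \in (`[0, 1]%classic : set R).
Proof. by rewrite inE /= in_itv /= lexx ler01. Qed.

Lemma mem1_unitI : (1 : R) \in (`[0, 1]%classic : set R).
Proof. by rewrite inE /= in_itv /= lexx ler01. Qed.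

Definition zeroI : unitI := exist _ 0 mem0_unitI.
Definition oneI : unitI := exist _ 1 mem1_unitI.

End UnitInterval.
Arguments zeroI {R}.
Arguments oneI {R}.

Lemma continuous_set_val (T : topologicalType) (A : set T) :
  continuous (set_val : A -> T).
Proof. exact: initial_continuous. Qed.

Lemma continuous_into_set (S T : topologicalType) (A : set T) (f : S -> A) :
  continuous (set_val \o f) -> continuous f.
Proof. exact: continuous_comp_initial. Qed.

Lemma continuous_pair (S T U : topologicalType) (f : S -> T) (g : S -> U) :
  continuous f -> continuous g -> continuous (fun z => (f z, g z)).
Proof. by move=> cf cg z; apply: cvg_pair; [exact: cf|exact: cg]. Qed.

Section FibrewiseSpaces.
Variable B : topologicalType.

Record fibrewiseSpace := FibrewiseSpace {
  fw_total :> topologicalType;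
  fw_proj : fw_total -> B;
  fw_proj_continuous : continuous fw_proj }.

Record fibrewiseMap (X Y : fibrewiseSpace) := FibrewiseMap {
  fw_fun :> X -> Y;
  fw_fun_continuous : continuous fw_fun;
  fw_fun_over : forall x, fw_proj (fw_fun x) = fw_proj x }.

Definition fw_id (X : fibrewiseSpace) : fibrewiseMap X X :=
  @FibrewiseMap X X idfun (fun x => cvg_id) (fun=> erefl).

Lemma fw_comp_continuous (X Y Z : fibrewiseSpace)
  (g : fibrewiseMap Y Z) (f : fibrewiseMap X Y) : continuous (g \o f).
Proof.
by move=> x; apply: continuous_comp; apply: fw_fun_continuous.
Qed.

Lemma fw_comp_over (X Y Z : fibrewiseSpace)
  (g : fibrewiseMap Y Z) (f : fibrewiseMap X Y) x :
  fw_proj ((g \o f) x) = fw_proj x.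
Proof. by rewrite /= !fw_fun_over. Qed.

Definition fw_comp (X Y Z : fibrewiseSpace)
    (g : fibrewiseMap Y Z) (f : fibrewiseMap X Y) : fibrewiseMap X Z :=
  FibrewiseMap (@fw_comp_continuous X Y Z g f) (@fw_comp_over X Y Z g f).

Lemma fw_sub_continuous (X : fibrewiseSpace) (U : set X) :
  continuous (@fw_proj X \o (set_val : U -> X)).
Proof.
move=> x; apply: continuous_comp; first exact: continuous_set_val.
exact: fw_proj_continuous.
Qed.

Definition fw_sub (X : fibrewiseSpace) (U : set X) : fibrewiseSpace :=
  FibrewiseSpace (@fw_sub_continuous X U).

Definition fw_inc (X : fibrewiseSpace) (U : set X) :
    fibrewiseMap (fw_sub U) X :=
  @FibrewiseMap (fw_sub U) X set_val (@continuous_set_val X U) (fun=> erefl).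

Definition fw_prod_set (X Y : fibrewiseSpace) : set (X * Y) :=
  [set xy | fw_proj xy.1 = fw_proj xy.2].
Arguments fw_prod_set : clear implicits.

Definition fw_prod_proj (X Y : fibrewiseSpace) (z : fw_prod_set X Y) : B :=
  fw_proj (set_val z).1.

Lemma fw_prod_fst_continuous (X Y : fibrewiseSpace) :
  continuous (fun z : fw_prod_set X Y => (set_val z).1).
Proof.
move=> z; apply: (@continuous_comp _ _ _ set_val fst).
  exact: continuous_set_val.
exact: cvg_fst.
Qed.

Lemma fw_prod_snd_continuous (X Y : fibrewiseSpace) :
  continuous (fun z : fw_prod_set X Y => (set_val z).2).
Proof.
move=> z; apply: (@continuous_comp _ _ _ set_val snd).
  exact: continuous_set_val.
exact: cvg_snd.
Qed.

Lemma fw_prod_proj_continuous (X Y : fibrewiseSpace) :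
  continuous (@fw_prod_proj X Y).
Proof.
move=> z; apply: (@continuous_comp _ _ _ (fun w : fw_prod_set X Y => (set_val w).1)).
  exact: fw_prod_fst_continuous.
exact: fw_proj_continuous.
Qed.

Definition fw_prod (X Y : fibrewiseSpace) : fibrewiseSpace :=
  FibrewiseSpace (@fw_prod_proj_continuous X Y).

Definition fw_pr1 (X Y : fibrewiseSpace) : fibrewiseMap (fw_prod X Y) X :=
  @FibrewiseMap (fw_prod X Y) X _ (@fw_prod_fst_continuous X Y) (fun=> erefl).

Definition fw_pr2 (X Y : fibrewiseSpace) : fibrewiseMap (fw_prod X Y) Y :=
  @FibrewiseMap (fw_prod X Y) Y _ (@fw_prod_snd_continuous X Y)
    (fun z => esym (set_valP z)).

Lemma fw_pair_mem (Z X Y : fibrewiseSpace)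
  (f : fibrewiseMap Z X) (g : fibrewiseMap Z Y) z :
  (f z, g z) \in fw_prod_set X Y.
Proof. by rewrite inE /fw_prod_set /= !fw_fun_over. Qed.

Definition fw_pair_fun (Z X Y : fibrewiseSpace)
    (f : fibrewiseMap Z X) (g : fibrewiseMap Z Y) (z : Z) : fw_prod X Y :=
  exist _ (f z, g z) (fw_pair_mem f g z).

Lemma fw_pair_continuous (Z X Y : fibrewiseSpace)
  (f : fibrewiseMap Z X) (g : fibrewiseMap Z Y) :
  continuous (fw_pair_fun f g).
Proof.
apply: continuous_into_set.
exact: (continuous_pair (@fw_fun_continuous _ _ f) (@fw_fun_continuous _ _ g)).
Qed.

Definition fw_pair (Z X Y : fibrewiseSpace)
    (f : fibrewiseMap Z X) (g : fibrewiseMap Z Y) :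
    fibrewiseMap Z (fw_prod X Y) :=
  @FibrewiseMap Z (fw_prod X Y) _ (@fw_pair_continuous Z X Y f g)
    (@fw_fun_over Z X f).

Record fibrewisePointedSpace := FibrewisePointedSpace {
  fw_space :> fibrewiseSpace;
  fw_sec : B -> fw_space;
  fw_sec_continuous : continuous fw_sec;
  fw_secK : forall b, fw_proj (fw_sec b) = b }.

Lemma fw_sec_proj_continuous (X : fibrewisePointedSpace) :
  continuous (@fw_sec X \o @fw_proj X).
Proof.
move=> x; apply: continuous_comp; first exact: fw_proj_continuous.
exact: fw_sec_continuous.
Qed.

Definition fw_sec_proj (X : fibrewisePointedSpace) : fibrewiseMap X X :=
  @FibrewiseMap X X _ (@fw_sec_proj_continuous X)
    (fun x => fw_secK X (fw_proj x)).

Lemma fw_prod_sec_mem (X Y : fibrewisePointedSpace) b :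
  (fw_sec X b, fw_sec Y b) \in fw_prod_set X Y.
Proof. by rewrite inE /fw_prod_set /= !fw_secK. Qed.

Definition fw_prod_sec (X Y : fibrewisePointedSpace) (b : B) : fw_prod X Y :=
  exist _ (fw_sec X b, fw_sec Y b) (fw_prod_sec_mem X Y b).

Lemma fw_prod_sec_continuous (X Y : fibrewisePointedSpace) :
  continuous (@fw_prod_sec X Y).
Proof.
apply: continuous_into_set.
exact: (continuous_pair (@fw_sec_continuous X) (@fw_sec_continuous Y)).
Qed.

Definition fw_pprod (X Y : fibrewisePointedSpace) : fibrewisePointedSpace :=
  @FibrewisePointedSpace (fw_prod X Y) _ (@fw_prod_sec_continuous X Y)
    (fw_secK X).

Definition fw_pointed (X Y : fibrewisePointedSpace) (f : fibrewiseMap X Y) :=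
  forall b, f (fw_sec X b) = fw_sec Y b.

End FibrewiseSpaces.
Arguments fw_prod_set {B} X Y.

Section FibrewiseHomotopy.
Variables (R : realType) (B : topologicalType).
Local Notation I := (unitI R).

Definition is_fw_homotopy (X Y : fibrewiseSpace B) (f g : fibrewiseMap X Y)
    (H : X * I -> Y) :=
  [/\ continuous H,
      forall x t, fw_proj (H (x, t)) = fw_proj x,
      forall x, H (x, zeroI) = f x &
      forall x, H (x, oneI) = g x].

Definition fw_homotopic (X Y : fibrewiseSpace B) (f g : fibrewiseMap X Y) :=
  exists H, is_fw_homotopy f g H.

(* Evaluating at the ends of [I] shows that [f] and [g] are then themselves
   fibrewise pointed. *)
Definition fw_phomotopic (X Y : fibrewisePointedSpace B)
    (f g : fibrewiseMap X Y) :=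
  exists2 H, is_fw_homotopy f g H &
    forall b t, H (fw_sec X b, t) = fw_sec Y b.

Record fibrewiseHSpace := FibrewiseHSpace {
  fwH_space :> fibrewisePointedSpace B;
  fwH_mul : fibrewiseMap (fw_pprod fwH_space fwH_space) fwH_space;
  fwH_mul_pointed : fw_pointed fwH_mul;
  fwH_unitr : fw_phomotopic
    (fw_comp fwH_mul (fw_pair (fw_id fwH_space) (fw_sec_proj fwH_space)))
    (fw_id fwH_space);
  fwH_unitl : fw_phomotopic
    (fw_comp fwH_mul (fw_pair (fw_sec_proj fwH_space) (fw_id fwH_space)))
    (fw_id fwH_space) }.

Definition is_fw_division (X : fibrewiseHSpace)
    (delta : fibrewiseMap (fw_pprod X X) X) :=
  fw_pointed delta /\
  fw_phomotopic (X := fw_pprod X X) (Y := X)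
    (fw_comp (fwH_mul X) (fw_pair (fw_pr1 X X) delta)) (fw_pr2 X X).

End FibrewiseHomotopy.

(* The least element of a set of naturals, with [None] standing for infinity. *)
Definition least (P : set nat) : option nat :=
  if pselect (exists n, (fun m => `[< P m >]) n) is left exP
  then Some (ex_minn exP) else None.

Lemma least_SomeP (P : set nat) n :
  least P = Some n <-> P n /\ forall m, P m -> (n <= m)%N.
Proof.
rewrite /least; case: pselect => [exP|nP]; last first.
  by split=> // -[Pn _]; case: nP; exists n; apply/asboolP.
case: ex_minnP => k /asboolP Pk mink; split=> [[<-]|[Pn minn]].
  by split=> // m Pm; apply/mink/asboolP.
by congr Some; apply/eqP; rewrite eqn_leq minn // mink //; apply/asboolP.
Qed.

Lemma least_NoneP (P : set nat) : least P = None <-> forall n, ~ P n.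
Proof.
rewrite /least; case: pselect => [[n Pn]|nP]; split=> //.
  by move=> /(_ n); case; apply/asboolP.
by move=> _ n Pn; apply: nP; exists n; apply/asboolP.
Qed.

Section PathSpace.
Import ArrowAsCompactOpen.
Variables (R : realType) (B : topologicalType) (X : fibrewiseSpace B).
Local Notation I := (unitI R).

(* Continuous maps [I -> X] with the compact-open topology. *)
Definition freePaths : topologicalType := continuousType I X.

Definition path_eval (t : I) (a : freePaths) : X :=
  (a : continuousType I X) t.

Definition fw_path_set : set (B * freePaths) :=
  [set ba | forall t, fw_proj (path_eval t ba.2) = ba.1].

Lemma path_eval_continuous (t : I) : continuous (path_eval t).
Proof.
apply/continuousP => O oO.
have oK : open ([set g | g @` [set t] `<=` O] : set {compact-open, I -> X}).
  by apply: compact_open_open => //; exact: compact_set1.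
suff -> : path_eval t @^-1` O =
    (id : continuousType I X -> (I -> X)) @^-1`
      [set g | g @` [set t] `<=` O].
  by exists [set g : I -> X | g @` [set t] `<=` O].
by apply/seteqP; split=> a /=; rewrite image_set1 /= sub1set inE.
Qed.

Lemma fw_path_fst_continuous :
  continuous (fun z : fw_path_set => (set_val z).1).
Proof.
move=> z; apply: (@continuous_comp _ _ _ set_val fst).
  exact: continuous_set_val.
exact: cvg_fst.
Qed.

Definition fw_pathSpace : fibrewiseSpace B :=
  FibrewiseSpace fw_path_fst_continuous.

Lemma fw_ends_mem (z : fw_pathSpace) :
  (path_eval zeroI (set_val z).2, path_eval oneI (set_val z).2)
    \in fw_prod_set X X.
Proof. by rewrite inE /fw_prod_set /= !(set_valP z). Qed.

Definition fw_ends_fun (z : fw_pathSpace) : fw_prod X X :=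
  exist _ (path_eval zeroI (set_val z).2, path_eval oneI (set_val z).2)
    (fw_ends_mem z).

Lemma fw_ends_continuous : continuous fw_ends_fun.
Proof.
have ev (t : I) :
    continuous (fun z : fw_pathSpace => path_eval t (set_val z).2).
  move=> z; apply: (@continuous_comp _ _ _ (fun w => (set_val w).2)).
    apply: (@continuous_comp _ _ _ set_val snd).
      exact: continuous_set_val.
    exact: cvg_snd.
  exact: path_eval_continuous.
apply: continuous_into_set.
exact: (continuous_pair (ev zeroI) (ev oneI)).
Qed.

(* The map [(b, a) |-> (a 0, a 1)]. *)
Definition fw_ends : fibrewiseMap fw_pathSpace (fw_prod X X) :=
  @FibrewiseMap B fw_pathSpace (fw_prod X X) _ fw_ends_continuous
    (fun z => set_valP z zeroI).

End PathSpace.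

Section Invariants.
Variables (R : realType) (B : topologicalType).

Definition open_cover (X : topologicalType) (n : nat)
    (U : 'I_n.+1 -> set X) :=
  (forall i, open (U i)) /\ \bigcup_i U i = setT.

Definition fw_cat (X : fibrewisePointedSpace B) : option nat :=
  least [set n | exists U : 'I_n.+1 -> set X, open_cover U /\
    forall i, fw_homotopic R (fw_inc (U i))
                             (fw_comp (fw_sec_proj X) (fw_inc (U i)))].

Definition fw_secat (E X : fibrewiseSpace B) (p : fibrewiseMap E X) :
    option nat :=
  least [set n | exists U : 'I_n.+1 -> set X, open_cover U /\
    forall i, exists s : fibrewiseMap (fw_sub (U i)) E,
      fw_homotopic R (fw_comp p s) (fw_inc (U i))].

Definition fw_TC (X : fibrewiseSpace B) : option nat :=
  fw_secat (fw_ends R X).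

End Invariants.

(* Main.v *)
Require Import Defs.
From mathcomp Require Import all_boot all_classical reals topology.
From mathcomp Require Import all_order all_algebra normedtype.

Set Implicit Arguments.
Unset Strict Implicit.
Unset Printing Implicit Defensive.

Import Order.TTheory GRing.Theory Num.Theory.
Import numFieldNormedType.Exports.

Local Open Scope classical_set_scope.
Local Open Scope ring_scope.

(** The two invariants are compared by translating both into statements about
    fibrewise homotopies on open sets.

    An open set [U] of the fibrewise square carries a section of the endpoint
    map up to fibrewise homotopy exactly when the two projections of the square
    are fibrewise homotopic on [U] ([fw_section_homotopyP]): such a homotopy is
    the same thing as a continuous choice of paths inside the fibres.

    So both invariants ask for open covers on whose members two fixed maps
    become homotopic, the two projections for the topological complexity, the
    identity and [s \o p] (with [s] the section and [p] the projection to the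
    base) for the category. Such covers can be pulled back along a fibrewise map
    ([open_cover_preimage], [fw_homotopic_preimage]), and each inequality is one
    pullback.

    - Category at most complexity: pull back along [x |-> (x, s (p x))], whose
      two components are the identity and [s \o p].
    - Complexity at most category: pull back along the division [delta], so that
      [delta] becomes homotopic to [s \o p \o delta]. On such a set
      [y ~ mu (x, delta (x, y)) ~ mu (x, s (p x)) ~ x], by the division
      property, the choice of the set, and the right unit.

    Thus the same numbers of open sets suffice on both sides. *)

(** * The unit interval *)

Section UnitIntervalTheory.
Variable R : realType.
Local Notation I := (unitI R).

Lemma clampI_mem (r : R) : Num.min 1 (Num.max 0 r) \in (`[0, 1]%classic : set R).
Proof.
rewrite inE /= in_itv /= ge_min lexx andbT le_min ler01 /=.
by rewrite le_max lexx.
Qed.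

(** Retracting the line onto the interval lets homotopies be reparametrized by
    arbitrary continuous functions of a real variable, without proving at each
    use that the new time lies between 0 and 1. *)
Definition clampI (r : R) : I :=
  exist _ (Num.min 1 (Num.max 0 r)) (clampI_mem r).

Lemma clampI_continuous : continuous clampI.
Proof.
apply: continuous_into_set => r.
rewrite (_ : _ \o _ = (fun r : R => Num.min 1 (Num.max 0 r))) //.
apply: (@continuous_min R R (fun=> 1) (fun r => Num.max 0 r)); first exact: cvg_cst.
apply: (@continuous_max R R (fun=> 0) id); first exact: cvg_cst.
exact: cvg_id.
Qed.

Lemma unitI_bounds (t : I) : 0 <= set_val t <= 1.
Proof. by have := set_valP t; rewrite /= in_itv. Qed.

Lemma clampI_le0 (r : R) : r <= 0 -> clampI r = zeroI.
Proof. by move=> r0; apply: val_inj; rewrite /= (max_idPl r0) (min_idPr ler01). Qed.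

Lemma clampI_ge1 (r : R) : 1 <= r -> clampI r = oneI.
Proof.
move=> r1; apply: val_inj; rewrite /= (max_idPr (le_trans ler01 r1)).
exact/min_idPl.
Qed.

Lemma clampI_val (t : I) : clampI (set_val t) = t.
Proof.
have /andP[t0 t1] := unitI_bounds t.
by apply: val_inj; rewrite /= (max_idPr t0) (min_idPr t1).
Qed.

Lemma unitI_compact : compact [set: I].
Proof.
have -> : [set: I] = clampI @` `[0, 1]%classic.
  apply/esym/seteqP; split=> // t _; exists (set_val t); last exact: clampI_val.
  exact: set_valP.
apply: continuous_compact; last exact: segment_compact.
exact/continuous_subspaceT/clampI_continuous.
Qed.

Lemma unitI_locally_compact : locally_compact [set: I].
Proof.
move=> t _; rewrite withinET; exists setT; first exact: filterT.
by split; [exact: unitI_compact|exact: closedT].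
Qed.

Lemma unitI_regular : regular_space I.
Proof. exact: (@uniform_regular (set_type (`[0, 1]%classic : set R))). Qed.

(** Evaluation is jointly continuous for the compact-open topology because the
    interval is locally compact and regular; this is what turns a continuous
    family of paths back into a homotopy. *)
Lemma path_eval_joint_continuous (B : topologicalType) (X : fibrewiseSpace B) :
  continuous (fun w : freePaths R X * I => path_eval w.2 w.1).
Proof.
rewrite (_ : (fun _ => _) = @eval I X); last by apply/funext => -[].
exact: eval_continuous unitI_locally_compact unitI_regular.
Qed.

End UnitIntervalTheory.

(** The gluing lemma for the closed sets [phi <= 0] and [0 <= phi], with both
    maps defined everywhere. Where [phi] has a strict sign, one of the two maps
    is used on a whole neighbourhood; where it vanishes, both maps tend to the
    same value. *)
Lemma continuous_paste (R : realType) (Z Y : topologicalType) (phi : Z -> R)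
    (f g : Z -> Y) :
  continuous phi -> continuous f -> continuous g ->
  (forall z, phi z = 0 -> f z = g z) ->
  continuous (fun z => if phi z <= 0 then f z else g z).
Proof.
move=> cphi cf cg fg z A /=; case: (ltrgtP (phi z) 0) => phiz.
- move=> /cf fA; have neg : \forall y \near z, phi y < 0.
    exact: (cphi z _ (lt_nbhsl phiz)).
  by apply: filterS2 neg fA => y /= /ltW ->.
- move=> /cg gA; have pos : \forall y \near z, 0 < phi y.
    exact: (cphi z _ (lt_nbhsr phiz)).
  by apply: filterS2 pos gA => y /= /lt_geF ->.
- move=> fA; have gA : nbhs (g z) A by rewrite -fg.
  have fA' : \forall y \near z, A (f y) by exact: cf.
  have gA' : \forall y \near z, A (g y) by exact: cg.
  by apply: filterS2 fA' gA' => y /= ? ?; case: ifP.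
Qed.

(** * Fibrewise homotopy *)

Section HomotopyTheory.
Variables (R : realType) (B : topologicalType).
Local Notation I := (unitI R).
Local Notation "f ~ g" := (fw_homotopic R f g) (at level 70).
Implicit Types X Y Z : fibrewiseSpace B.

Lemma reparam_continuous (Z : topologicalType) (a : R -> R) :
  continuous a -> continuous (fun z : Z * I => (z.1, clampI (a (set_val z.2)))).
Proof.
move=> ca; apply: continuous_pair; first by move=> z; exact: cvg_fst.
move=> z; apply: (@continuous_comp _ _ _ snd (fun t => clampI (a (set_val t)))).
  exact: cvg_snd.
apply: (@continuous_comp _ _ _ (fun t : I => set_val t) (fun r => clampI (a r))).
  exact: continuous_set_val.
by apply: continuous_comp; [exact: ca|exact: clampI_continuous].
Qed.

Lemma fw_homotopic_eq X Y (f g : fibrewiseMap X Y) : f =1 g -> f ~ g.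
Proof.
move=> fg; exists (fun z => f z.1); split=> //=.
- move=> z; apply: (@continuous_comp _ _ _ fst); first exact: cvg_fst.
  exact: fw_fun_continuous.
- by move=> x _; exact: fw_fun_over.
Qed.

Lemma fw_homotopic_sym X Y (f g : fibrewiseMap X Y) : f ~ g -> g ~ f.
Proof.
move=> [H [cH Hp H0 H1]].
exists (fun z => H (z.1, clampI (1 - set_val z.2))); split=> /=.
- move=> z; apply: (@continuous_comp _ _ _
    (fun z : X * I => (z.1, clampI (1 - set_val z.2)))); last exact: cH.
  apply: (@reparam_continuous _ (fun r => 1 - r)) => r.
  by apply: cvgB; [exact: cvg_cst|exact: cvg_id].
- by move=> x t; exact: Hp.
- by move=> x; rewrite clampI_ge1 ?subr0.
- by move=> x; rewrite clampI_le0 ?subrr.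
Qed.

Lemma fw_homotopic_trans X Y (f g h : fibrewiseMap X Y) :
  f ~ g -> g ~ h -> f ~ h.
Proof.
move=> [H [cH Hp H0 H1]] [K [cK Kp K0 K1]].
(* The first homotopy runs at double speed while [b <= 0]; where [b] vanishes
   the clamped times are 1 for [H] and 0 for [K], and both values are [g]. *)
pose a (r : R) := r * 2; pose b (r : R) := r * 2 - 1.
have ca : continuous a.
  by move=> r; apply: cvgM; [exact: cvg_id|exact: cvg_cst].
have cb : continuous b.
  by move=> r; apply: cvgB; [exact: ca|exact: cvg_cst].
exists (fun z => if b (set_val z.2) <= 0 then H (z.1, clampI (a (set_val z.2)))
                 else K (z.1, clampI (b (set_val z.2)))); split=> /=.
- apply: continuous_paste.
  + move=> z; apply: (@continuous_comp _ _ _ snd (fun t : I => b (set_val t))).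
      exact: cvg_snd.
    by apply: continuous_comp; [exact: continuous_set_val|exact: cb].
  + move=> z; apply: (@continuous_comp _ _ _
      (fun z : X * I => (z.1, clampI (a (set_val z.2))))); last exact: cH.
    exact: reparam_continuous.
  + move=> z; apply: (@continuous_comp _ _ _
      (fun z : X * I => (z.1, clampI (b (set_val z.2))))); last exact: cK.
    exact: reparam_continuous.
  + move=> z bz; rewrite clampI_ge1 ?H1 ?clampI_le0 ?K0 ?bz//.
    by rewrite -subr_ge0 -/(b _) bz.
- by move=> x t; case: ifP.
- by move=> x; rewrite /a /b mul0r sub0r oppr_le0 ler01 clampI_le0.
- move=> x; rewrite /b mul1r -addrA subrr addr0 ler10.
  by rewrite clampI_ge1.
Qed.

Lemma fw_homotopic_post X Y Z (g : fibrewiseMap Y Z) (f f' : fibrewiseMap X Y) :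
  f ~ f' -> fw_comp g f ~ fw_comp g f'.
Proof.
move=> [H [cH Hp H0 H1]]; exists (g \o H); split=> /=.
- by move=> z; apply: continuous_comp; [exact: cH|exact: fw_fun_continuous].
- by move=> x t; rewrite fw_fun_over.
- by move=> x; rewrite H0.
- by move=> x; rewrite H1.
Qed.

Lemma fw_homotopic_pre X Y Z (g g' : fibrewiseMap Y Z) (f : fibrewiseMap X Y) :
  g ~ g' -> fw_comp g f ~ fw_comp g' f.
Proof.
move=> [H [cH Hp H0 H1]]; exists (fun z => H (f z.1, z.2)); split=> //=.
- move=> z; apply: (@continuous_comp _ _ _ (fun z : X * I => (f z.1, z.2))).
    apply: continuous_pair => {}z; last exact: cvg_snd.
    apply: (@continuous_comp _ _ _ fst); first exact: cvg_fst.
    exact: fw_fun_continuous.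
  exact: cH.
- by move=> x t; rewrite Hp fw_fun_over.
Qed.

Lemma fw_homotopic_pairr Z X Y (f : fibrewiseMap Z X) (g g' : fibrewiseMap Z Y) :
  g ~ g' -> fw_pair f g ~ fw_pair f g'.
Proof.
move=> [H [cH Hp H0 H1]].
have mem (z : Z * I) : (f z.1, H z) \in fw_prod_set X Y.
  by rewrite inE /fw_prod_set /=; case: z => z t /=; rewrite Hp fw_fun_over.
exists (fun z => exist _ (f z.1, H z) (mem z) : fw_prod X Y); split=> /=.
- apply: continuous_into_set; apply: continuous_pair => // z.
  apply: (@continuous_comp _ _ _ fst); first exact: cvg_fst.
  exact: fw_fun_continuous.
- by move=> z t; rewrite /fw_prod_proj /= fw_fun_over.
- by move=> z; apply: val_inj; rewrite /= H0.
- by move=> z; apply: val_inj; rewrite /= H1.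
Qed.

(** Precomposition with the map from the preimage of [V] to [V] that [f]
    restricts to. *)
Lemma fw_homotopic_preimage X Y Z (g g' : fibrewiseMap Y Z) (V : set Y)
    (f : fibrewiseMap X Y) :
  fw_comp g (fw_inc V) ~ fw_comp g' (fw_inc V) ->
  fw_comp (fw_comp g f) (fw_inc (f @^-1` V)) ~
  fw_comp (fw_comp g' f) (fw_inc (f @^-1` V)).
Proof.
have mem (u : fw_sub (f @^-1` V)) : f (set_val u) \in V.
  by rewrite inE; exact: (set_valP u).
pose r (u : fw_sub (f @^-1` V)) : fw_sub V :=
  exist _ (f (set_val u)) (mem u).
have cr : continuous r.
  apply: continuous_into_set => u.
  exact: (@fw_comp_continuous _ _ _ _ f (fw_inc (f @^-1` V))).
have rp u : fw_proj (r u) = fw_proj u by exact: fw_fun_over.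
by move/(@fw_homotopic_pre _ _ _ _ _ (FibrewiseMap cr rp)).
Qed.

(** * Local sections of the endpoint map *)

(** Given a section [s] up to homotopy, the first projection is deformed to the
    start of the path [s u], along that path to its end, and from there to the
    second projection. Conversely the tracks of a homotopy between the
    projections are paths in the fibres, and currying makes them a strict
    section. *)
Lemma fw_section_homotopyP X (U : set (fw_prod X X)) :
  (exists s : fibrewiseMap (fw_sub U) (fw_pathSpace R X),
     fw_comp (fw_ends R X) s ~ fw_inc U) <->
  fw_comp (fw_pr1 X X) (fw_inc U) ~ fw_comp (fw_pr2 X X) (fw_inc U).
Proof.
split=> [[s sU]|[H [cH Hp H0 H1]]].
  have mid : fw_comp (fw_pr1 X X) (fw_comp (fw_ends R X) s) ~
             fw_comp (fw_pr2 X X) (fw_comp (fw_ends R X) s).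
    exists (fun z => path_eval z.2 (set_val (s z.1)).2); split=> //=.
      move=> z; apply: (@continuous_comp _ _ _
        (fun z : fw_sub U * I => ((set_val (s z.1)).2, z.2))
        (fun w : freePaths R X * I => path_eval w.2 w.1)); last first.
        exact: path_eval_joint_continuous.
      apply: continuous_pair => {}z; last exact: cvg_snd.
      apply: (@continuous_comp _ _ _ (fun z : fw_sub U * I => set_val (s z.1)) snd).
        apply: (@continuous_comp _ _ _ (fun z : fw_sub U * I => s z.1)).
          apply: (@continuous_comp _ _ _ fst); first exact: cvg_fst.
          exact: fw_fun_continuous.
        exact: continuous_set_val.
      exact: cvg_snd.
    by move=> u t; rewrite (set_valP (s u)); exact: (fw_fun_over s).
  apply: fw_homotopic_trans (fw_homotopic_post (fw_pr2 X X) sU).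
  apply: fw_homotopic_trans mid.
  exact: fw_homotopic_sym (fw_homotopic_post (fw_pr1 X X) sU).
have cHu u : continuous (curry H u) := (continuous_curry cH).2 u.
pose a (u : fw_sub U) : freePaths R X := mkcts (cHu u).
have ca : continuous a.
  apply: (@continuous_comp_initial _ _ _
    (id : continuousType I X -> {compact-open, I -> X})).
  exact: (continuous_curry cH).1.
have mem (u : fw_sub U) : (fw_proj u, a u) \in @fw_path_set R B X.
  by rewrite inE => t; exact: Hp.
pose s (u : fw_sub U) : fw_pathSpace R X :=
  exist _ (fw_proj u, a u) (mem u).
have cs : continuous s.
  apply: continuous_into_set; apply: continuous_pair => //.
  exact: fw_proj_continuous.
exists (@FibrewiseMap _ (fw_sub U) (fw_pathSpace R X) s cs (fun=> erefl)).
apply: fw_homotopic_eq => u; apply: val_inj.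
rewrite [RHS]surjective_pairing.
by congr (_, _); [exact: H0|exact: H1].
Qed.

End HomotopyTheory.

(** * Comparison of covers *)

Lemma open_cover_preimage (S T : topologicalType) (f : S -> T) n
    (U : 'I_n.+1 -> set T) :
  continuous f -> open_cover U -> open_cover (fun i => f @^-1` U i).
Proof.
move=> /continuousP cf [oU cU]; split=> [i|]; first exact: cf.
by rewrite -preimage_bigcup cU preimage_setT.
Qed.

Theorem corollary5p11 (R : realType) (B : topologicalType)
    (X : fibrewiseHSpace R B) :
  (exists delta : fibrewiseMap (fw_pprod X X) X, is_fw_division delta) ->
  fw_TC R X = fw_cat R X.
Proof.
move=> [delta [_ [D Ddiv _]]]; have {Ddiv D} divE := ex_intro _ D Ddiv.
rewrite /fw_TC /fw_secat /fw_cat; congr least.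
apply/seteqP; split=> n [U [covU homU]].
  pose j := fw_pair (fw_id X) (fw_sec_proj X).
  exists (fun i => j @^-1` U i); split.
    exact: open_cover_preimage (@fw_fun_continuous _ _ _ j) covU.
  move=> i; have /fw_section_homotopyP homi := homU i.
  exact: (@fw_homotopic_preimage _ _ _ _ _ _ _ (U i) j homi).
exists (fun i => delta @^-1` U i); split.
  exact: open_cover_preimage (@fw_fun_continuous _ _ _ delta) covU.
move=> i; apply/fw_section_homotopyP; apply: fw_homotopic_sym.
(* In fibre coordinates [(x, y)], the chain is
   [y ~ mu (x, delta (x, y)) ~ mu (x, s (p x)) ~ x]. *)
pose inc : fibrewiseMap _ (fw_prod X X) := fw_inc (delta @^-1` U i).
pose mul := fwH_mul X; pose pr1 := fw_comp (fw_pr1 X X) inc.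
have to_section : fw_homotopic R (fw_comp delta inc)
    (fw_comp (fw_comp (fw_sec_proj X) delta) inc).
  exact: (@fw_homotopic_preimage _ _ _ _ _ (fw_id X) _ _ delta (homU i)).
have divK : fw_homotopic R (fw_comp (fw_pr2 X X) inc)
    (fw_comp mul (fw_pair pr1 (fw_comp delta inc))).
  apply: fw_homotopic_trans (fw_homotopic_sym (fw_homotopic_pre inc divE)) _.
  by apply: fw_homotopic_eq => u; congr (mul _); apply: val_inj.
have unitK : fw_homotopic R
    (fw_comp mul (fw_pair pr1 (fw_comp (fw_comp (fw_sec_proj X) delta) inc))) pr1.
  have [K homK _] := fwH_unitr X.
  have := fw_homotopic_pre pr1 (ex_intro _ K homK).
  apply: fw_homotopic_trans.
  apply: fw_homotopic_eq => u; congr (mul _); apply: val_inj => /=.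
  by congr (_, fw_sec _ _); exact: fw_fun_over.
apply: fw_homotopic_trans divK (fw_homotopic_trans _ unitK).
exact/fw_homotopic_post/fw_homotopic_pairr.
Qed.
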